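(* Let $G$ and $H$ be two commensurable finitely generated groups. Then $\mathfrak{M}_{\mathtt{SFT}}(G)=\mathfrak{M}_{\mathtt{SFT}}(H)$ and $\mathfrak{M}_{\mathtt{SOF}}(G)=\mathfrak{M}_{\mathtt{SOF}}(H)$.
   Context: Two groups $G,H$ are commensurable if there are finite index subgroups $G'\leqslant G$ and $H'\leqslant H$ which are isomorphic. Alphabets are finite. For a group $G$ and alphabet $A$, $A^G=\{x\colon G\to A\}$ carries the prodiscrete topology and the shift action $(gx)(h)=x(g^{-1}h)$. A $G$-subshift is a closed $G$-invariant set $X\subset A^G$. For finite $F\subset G$ and a pattern $p\in A^F$ let $[p]=\{x\in A^G: x|_F=p\}$. $X$ is a subshift of finite type (SFT) if there is a finite set $\mathcal F$ of patterns with $X=\{x: gx\notin[p]\ \forall g\in G,\ p\in\mathcal F\}$. A subshift is sofic if it is the image of an SFT under a continuous $G$-equivariant map. Medvedev degrees: for $P,Q\subset\{0,1\}^{\mathbb N}$ write $P\le Q$ if there is a partial computable function $\Psi$ on $\{0,1\}^{\mathbb N}$ (a Turing functional) defined on all of $Q$ with $\Psi(Q)\subset P$. The Medvedev degree $m(P)$ is the class of $P$ under the equivalence $P\le Q\le P$. For a group $G$ with finite generating set $S$, free group $F(S)$ and canonical epimorphism $\rho\colon F(S)\to G$, the pullback of a subshift $X\subset A^G$ is $\widehat X=\{x\circ\rho: x\in X\}\subset A^{F(S)}$. Via a computable bijection $\mathbb N\to F(S)$ and a fixed-length binary coding of $A$, $\widehat X$ is identified with a subset of $\{0,1\}^{\mathbb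 N}$, and $m(X):=m(\widehat X)$ (independent of choices). $\mathfrak{M}_{\mathtt{SFT}}(G)$ and $\mathfrak{M}_{\mathtt{SOF}}(G)$ are the sets of degrees $m(X)$ for $X$ a nonempty $G$-SFT, respectively a nonempty sofic $G$-subshift. *)

(* Defs.v *)
From Stdlib Require Cantor.
From mathcomp Require Import all_boot finmap.
From mathcomp Require Import boolp classical_sets functions cardinality topology.

Set Implicit Arguments.
Unset Strict Implicit.
Unset Printing Implicit Defensive.

Local Open Scope classical_set_scope.

(* A [groupType] is an arbitrary, possibly infinite, group; it carries a
   choice structure, which is available on every type by the axioms of
   [boolp] and has no computational content.  A [groupClosed G] is a subgroup
   of G, given by its characteristic predicate. *)

Definition finite_index (G : groupType) (K : groupClosed G) : Prop :=
  finite_set (range (fun g : G => [set (g * k)%g | k in [set` K]])).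

Definition isomorphic_subgroups (G H : groupType)
    (K : groupClosed G) (L : groupClosed H) : Prop :=
  exists2 f : G -> H,
    {in K &, {morph f : x y / (x * y)%g}} & set_bij [set` K] [set` L] f.

Definition commensurable (G H : groupType) : Prop :=
  exists (K : groupClosed G) (L : groupClosed H),
    [/\ finite_index K, finite_index L & isomorphic_subgroups K L].

(* The free group F(S) is the set of reduced words; the letter (s, true)
   stands for s and (s, false) for s^-1. *)

Section FreeGroup.
Variables (G : groupType) (S : {fset G}).

Definition not_inverse (a b : S * bool) : bool :=
  ~~ ((a.1 == b.1) && (a.2 != b.2)).

Definition free_group : Type := {w : seq (S * bool) | sorted not_inverse w}.

Definition rho (w : free_group) : G :=
  (\prod_(a <- val w) (if a.2 then val a.1 else (val a.1)^-1))%g.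

Definition generates : Prop := forall g : G, exists w : free_group, rho w = g.

End FreeGroup.

Section Subshifts.
Variable G : groupType.

Definition fullshift (A : finType) : topologicalType :=
  prod_topology (fun _ : G => discrete_topology A).

Definition translate (A : finType) (g : G) (x : fullshift A) : fullshift A :=
  fun h => x (g^-1 * h)%g.

Definition subshift (A : finType) (X : set (fullshift A)) : Prop :=
  closed X /\ forall g x, X x -> X (translate g x).

(* A pattern p in A^F, F a finite subset of G, is a finite map with domain F. *)
Definition cylinder (A : finType) (p : {fmap G -> A}) : set (fullshift A) :=
  [set x | forall h a, p.[? h]%fmap = Some a -> x h = a].

Definition SFT (A : finType) (X : set (fullshift A)) : Prop :=
  subshift X /\
  exists F : {fset {fmap G -> A}},
    X = [set x | forall g p, p \in F -> ~ cylinder p (translate g x)].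

Definition sofic (A : finType) (X : set (fullshift A)) : Prop :=
  subshift X /\
  exists (B : finType) (Y : set (fullshift B))
         (phi : fullshift B -> fullshift A),
    [/\ SFT Y,
        {within Y, continuous phi},
        forall g y, Y y -> phi (translate g y) = translate g (phi y) &
        X = phi @` Y].

End Subshifts.

(* Partial recursive functions relative to an oracle x in {0,1}^N, as unary
   partial functions on nat; several arguments are packed with the Cantor
   pairing bijection. *)

Definition pair_nat (a b : nat) : nat := Cantor.to_nat (a, b).

Inductive code : Type :=
| Zero | Succ | Fst | Snd | Oracle
| Pair of code & code
| Comp of code & code
| PrimRec of code & code
| Mu of code.

(* [run x e n m]: program e with oracle x halts on input n with output m. *)
Inductive run (x : nat -> bool) : code -> nat -> nat -> Prop :=
| RunZero n : run x Zero n 0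
| RunSucc n : run x Succ n n.+1
| RunFst a b : run x Fst (pair_nat a b) a
| RunSnd a b : run x Snd (pair_nat a b) b
| RunOracle n : run x Oracle n (x n)
| RunPair e f n a b :
    run x e n a -> run x f n b -> run x (Pair e f) n (pair_nat a b)
| RunComp e f n a b :
    run x f n a -> run x e a b -> run x (Comp e f) n b
| RunPrimRec0 e f a b :
    run x e a b -> run x (PrimRec e f) (pair_nat a 0) b
| RunPrimRecS e f a n b c :
    run x (PrimRec e f) (pair_nat a n) b ->
    run x f (pair_nat a (pair_nat n b)) c ->
    run x (PrimRec e f) (pair_nat a n.+1) c
| RunMu e a n (v : nat -> nat) :
    run x e (pair_nat a n) 0 ->
    (forall i, i < n -> run x e (pair_nat a i) (v i).+1) ->
    run x (Mu e) a n.

Definition computable (f : nat -> nat) : Prop :=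
  exists e : code, forall n, run (fun=> false) e n (f n).

Definition cantor : Type := nat -> bool.

(* The Turing functional of e is defined at x with value y. *)
Definition functional (e : code) (x y : cantor) : Prop :=
  forall n, run x e n (y n).

Definition medvedev_le (P Q : set cantor) : Prop :=
  exists e : code, forall x, Q x -> exists2 y, P y & functional e x y.

Definition medvedev_degree (P : set cantor) : set (set cantor) :=
  [set Q | medvedev_le P Q /\ medvedev_le Q P].

(* Computability of a map into F(S) refers to this standard numbering of
   words by natural numbers. *)
Definition word_code (T : finType) (w : seq T) : nat :=
  foldr (fun a n => (pair_nat (enum_rank a) n).+1) 0 w.

Record numbering (G : groupType) (S : {fset G}) := Numbering {
  num :> nat -> free_group S;
  num_bij : bijective num;
  num_computable : computable (fun n => word_code (val (num n)))
}.

(* An injective coding of A by binary words of fixed length [width.+1]; the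
   length is positive so that a configuration is coded by an infinite sequence,
   even when A is a singleton. *)
Record coding (A : finType) := Coding {
  width : nat;
  enc :> A -> width.+1.-tuple bool;
  enc_inj : injective enc
}.

Section Degrees.
Variables (G : groupType) (S : {fset G}) (nu : numbering S).

Definition pullback (A : finType) (X : set (fullshift G A)) :
    set (free_group S -> A) :=
  [set (fun w => x (rho w)) | x in X].

(* The concatenation of the codes of y (nu 0), y (nu 1), and so on. *)
Definition encode (A : finType) (c : coding A) (y : free_group S -> A) :
    cantor :=
  fun n => nth false (c (y (nu (n %/ (width c).+1)))) (n %% (width c).+1).

Definition degree (A : finType) (c : coding A) (X : set (fullshift G A)) :
    set (set cantor) :=
  medvedev_degree (encode c @` pullback X).

(* The degree does not depend on S, nu and the codings c, so they are kept as
   parameters. *)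
Variable c : forall A : finType, coding A.

Definition M_SFT : set (set (set cantor)) :=
  [set d | exists (A : finType) (X : set (fullshift G A)),
     [/\ SFT X, X !=set0 & d = degree (c A) X]].

Definition M_SOF : set (set (set cantor)) :=
  [set d | exists (A : finType) (X : set (fullshift G A)),
     [/\ sofic X, X !=set0 & d = degree (c A) X]].

End Degrees.

(* Main.v *)
From Stdlib Require Cantor.
Require Import Defs.
From mathcomp Require Import all_boot finmap.
From mathcomp Require Import boolp classical_sets functions cardinality topology.

(* Let f : K -> L be an isomorphism between finite-index subgroups of G and H,
   and let (t i) be a right transversal of K.  A G-subshift X with alphabet A
   induces an H-subshift with alphabet A^Q, Q = K \ G: on each left coset h L,
   the letter at h f(k) stores the values at the points k (t i) of a
   G-configuration, which has to lie in X.  Finite windows and block codes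
   transport, so SFTs and sofic subshifts induce SFTs and sofic subshifts.  The
   configurations on different cosets of L are independent, so one may copy the
   same point of X on each of them; hence X and the induced subshift compute
   each other, as the coset decompositions of G and H are computed on words by
   the finite Schreier graphs of K and L.  By symmetry the sets of degrees are
   equal. *)

Set Implicit Arguments.
Unset Strict Implicit.
Unset Printing Implicit Defensive.

(** * Recursive functionals *)

Definition fst_nat (n : nat) : nat := (Cantor.of_nat n).1.
Definition snd_nat (n : nat) : nat := (Cantor.of_nat n).2.

Lemma fst_natK a b : fst_nat (pair_nat a b) = a.
Proof. by rewrite /fst_nat /pair_nat Cantor.cancel_of_to. Qed.

Lemma snd_natK a b : snd_nat (pair_nat a b) = b.
Proof. by rewrite /snd_nat /pair_nat Cantor.cancel_of_to. Qed.

Lemma pair_natK n : pair_nat (fst_nat n) (snd_nat n) = n.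
Proof.
rewrite /fst_nat /snd_nat /pair_nat -{3}[n]Cantor.cancel_to_of.
by case: Cantor.of_nat.
Qed.

Lemma leq_pair_natr a b : b <= pair_nat a b.
Proof.
apply: leq_trans (leq_addr a b) _; apply/leP.
exact: Cantor.to_nat_non_decreasing.
Qed.

Lemma pair_nat_inj a b a' b' : pair_nat a b = pair_nat a' b' -> a = a' /\ b = b'.
Proof. by move=> /Cantor.to_nat_inj []. Qed.

Opaque pair_nat.

(** One code serves all oracles and halts on every input, so such functionals compose like ordinary
    functions. *)
Definition recursive (F : cantor -> nat -> nat) : Prop :=
  exists e : code, forall x n, run x e n (F x n).

Fixpoint subst_oracle (d e : code) : code :=
  match e with
  | Oracle => d
  | Pair e f => Pair (subst_oracle d e) (subst_oracle d f)
  | Comp e f => Comp (subst_oracle d e) (subst_oracle d f)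
  | PrimRec e f => PrimRec (subst_oracle d e) (subst_oracle d f)
  | Mu e => Mu (subst_oracle d e)
  | e => e
  end.

Lemma run_subst_oracle d e (x y : cantor) n m :
  functional d x y -> run y e n m -> run x (subst_oracle d e) n m.
Proof.
move=> dxy; elim=> {e n m} /=; try by move=> *; econstructor; eauto.
by move=> n; apply: dxy.
Qed.

Lemma medvedev_le_trans P Q R :
  medvedev_le P Q -> medvedev_le Q R -> medvedev_le P R.
Proof.
move=> [d dP] [e eP]; exists (subst_oracle e d) => x Rx.
have [y Qy exy] := eP x Rx; have [z Pz dyz] := dP y Qy.
by exists z => // n; apply: run_subst_oracle (dyz n).
Qed.

Lemma eq_medvedev_degree P Q :
  medvedev_le P Q -> medvedev_le Q P -> medvedev_degree P = medvedev_degree Q.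
Proof.
move=> PQ QP; apply/seteqP; split=> U /= [h1 h2]; split;
  by eauto using medvedev_le_trans.
Qed.

Lemma computable_recursive f : computable f -> recursive (fun=> f).
Proof.
move=> [e eP]; exists (subst_oracle Zero e) => x n.
by apply: run_subst_oracle (eP n) => m; apply: RunZero.
Qed.

Section RecursiveClosure.
Implicit Types F N A B : cantor -> nat -> nat.

Lemma eq_recursive F F' : (forall x n, F x n = F' x n) -> recursive F -> recursive F'.
Proof. by move=> E [e eP]; exists e => x n; rewrite -E. Qed.

Lemma recursive_comp F N :
  recursive F -> recursive N -> recursive (fun x n => F x (N x n)).
Proof. by move=> [e eP] [d dP]; exists (Comp e d) => x n; econstructor; eauto. Qed.

Lemma recursive_pair A B :
  recursive A -> recursive B -> recursive (fun x n => pair_nat (A x n) (B x n)).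
Proof. by move=> [e eP] [d dP]; exists (Pair e d) => x n; econstructor; eauto. Qed.

Lemma recursive_fst : recursive (fun=> fst_nat).
Proof.
by exists Fst => x n; rewrite -{1}[n]pair_natK; apply: RunFst.
Qed.

Lemma recursive_snd : recursive (fun=> snd_nat).
Proof.
by exists Snd => x n; rewrite -{1}[n]pair_natK; apply: RunSnd.
Qed.

Lemma recursive_id : recursive (fun=> id).
Proof.
apply: eq_recursive (recursive_pair recursive_fst recursive_snd) => x n.
exact: pair_natK.
Qed.

Lemma recursive_succ : recursive (fun=> S).
Proof. by exists Succ => x n; apply: RunSucc. Qed.

Lemma recursive_const k : recursive (fun _ _ => k).
Proof.
elim: k => [|k IH]; first by exists Zero => x n; apply: RunZero.
exact: (recursive_comp recursive_succ IH).
Qed.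

Lemma recursive_oracle : recursive (fun x n => x n).
Proof. by exists Oracle => x n; apply: RunOracle. Qed.

Lemma recursive_primrec A F N : recursive A -> recursive F -> recursive N ->
  recursive (fun x n => nat_rect (fun=> nat) (A x n)
    (fun k b => F x (pair_nat n (pair_nat k b))) (N x n)).
Proof.
move=> [e eP] [f fP] RN.
have RP : recursive (fun x n => nat_rect (fun=> nat) (A x (fst_nat n))
    (fun k b => F x (pair_nat (fst_nat n) (pair_nat k b))) (snd_nat n)).
  exists (PrimRec e f) => x n; rewrite -{1}[n]pair_natK.
  move: (fst_nat n) (snd_nat n) => a m {n}.
  by elim: m => [|m IH] /=; econstructor; eauto.
have := recursive_comp RP (recursive_pair recursive_id RN).
by apply: eq_recursive => x n; rewrite fst_natK snd_natK.
Qed.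

Lemma recursive_natcase A B N : recursive A -> recursive B -> recursive N ->
  recursive (fun x n => if N x n is k.+1 then B x (pair_nat n k) else A x n).
Proof.
move=> RA RB RN.
have RB' : recursive (fun x n => B x (pair_nat (fst_nat n) (fst_nat (snd_nat n)))).
  apply: recursive_comp RB _; apply: recursive_pair recursive_fst _.
  exact: recursive_comp recursive_fst recursive_snd.
apply: eq_recursive (recursive_primrec RA RB' RN) => x n.
by case: (N x n) => //= k; rewrite snd_natK !fst_natK.
Qed.

Lemma recursive_iter A F N : recursive A -> recursive F -> recursive N ->
  recursive (fun x n => iter (N x n) (F x) (A x n)).
Proof.
move=> RA RF RN.
have RF' : recursive (fun x n => F x (snd_nat (snd_nat n))).
  apply: recursive_comp RF _; exact: recursive_comp recursive_snd recursive_snd.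
apply: eq_recursive (recursive_primrec RA RF' RN) => x n.
by elim: (N x n) => //= k ->; rewrite !snd_natK.
Qed.

Lemma recursive_pred N : recursive N -> recursive (fun x n => (N x n).-1).
Proof.
move=> RN.
have := recursive_natcase (recursive_const 0) recursive_snd RN.
by apply: eq_recursive => x n; case: (N x n) => //= k; rewrite snd_natK.
Qed.

Lemma recursive_sub A B : recursive A -> recursive B ->
  recursive (fun x n => A x n - B x n).
Proof.
move=> RA RB.
have := recursive_iter RA (recursive_pred recursive_id) RB.
by apply: eq_recursive => x n; elim: (B x n) => [|k IH]; rewrite ?subn0 //= IH subnS.
Qed.

Lemma recursive_iszero A B N : recursive A -> recursive B -> recursive N ->
  recursive (fun x n => if N x n == 0 then A x n else B x n).
Proof.
move=> RA RB RN.
have := recursive_natcase RA (recursive_comp RB recursive_fst) RN.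
by apply: eq_recursive => x n; case: (N x n) => //= k; rewrite fst_natK.
Qed.

Lemma recursive_ifeq A B M N :
  recursive A -> recursive B -> recursive M -> recursive N ->
  recursive (fun x n => if M x n == N x n then A x n else B x n).
Proof.
move=> RA RB RM RN.
have := recursive_iszero (recursive_iszero RA RB (recursive_sub RN RM)) RB
  (recursive_sub RM RN).
apply: eq_recursive => x n; rewrite !subn_eq0 eqn_leq.
by case: (_ <= _).
Qed.

(** The result [G x n] is named in advance as the least zero, so the unbounded search halts for
    every oracle and input. *)
Lemma recursive_mu F G : recursive F ->
  (forall x n, F x (pair_nat n (G x n)) = 0) ->
  (forall x n i, i < G x n -> F x (pair_nat n i) != 0) ->
  recursive G.
Proof.
move=> [e eP] F0 Fn0; exists (Mu e) => x n.
apply: (RunMu (v := fun i => (F x (pair_nat n i)).-1)); first by rewrite -(F0 x n).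
by move=> i iG; rewrite prednK ?lt0n ?Fn0.
Qed.

(** The codes of the [G i] are unrelated, but there are only finitely many: one program dispatches
    on the index, with [G 0] split off at each induction step. *)
Lemma recursive_cases (G : nat -> cantor -> nat -> nat) k :
  (forall i, i < k -> recursive (G i)) ->
  exists2 G' : cantor -> nat -> nat, recursive G' &
    forall i x n, i < k -> G' x (pair_nat n i) = G i x n.
Proof.
elim: k G => [|k IH] G RG; first by exists (fun=> id); [apply: recursive_id|].
have [G' RG' E] := IH (fun i => G i.+1) (fun i ik => RG i.+1 ik).
exists (fun x n => if snd_nat n is i.+1 then G' x (pair_nat (fst_nat n) i)
                   else G 0 x (fst_nat n)).
  have RG'' : recursive (fun x n => G' x (pair_nat (fst_nat (fst_nat n)) (snd_nat n))).
    apply: recursive_comp RG' _; apply: recursive_pair recursive_snd.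
    exact: recursive_comp recursive_fst recursive_fst.
  have := recursive_natcase
    (recursive_comp (RG 0 isT) recursive_fst) RG'' recursive_snd.
  by apply: eq_recursive => x n; case: (snd_nat n) => // i; rewrite fst_natK snd_natK.
by move=> [|i] x n ik; rewrite snd_natK fst_natK // E.
Qed.

Lemma recursive_divmod d : 0 < d ->
  recursive (fun _ n => n %/ d) /\ recursive (fun _ n => n %% d).
Proof.
move=> d0.
(* The state holds quotient and remainder; the remainder carries on reaching [d]. *)
pose st n := if (snd_nat n).+1 == d then pair_nat (fst_nat n).+1 0
             else pair_nat (fst_nat n) (snd_nat n).+1.
have Rs : recursive (fun=> st).
  have sS := recursive_comp recursive_succ recursive_snd.
  apply: (recursive_ifeq _ _ sS (recursive_const d)).
    apply: recursive_pair (recursive_const 0).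
    exact: recursive_comp recursive_succ recursive_fst.
  exact: recursive_pair recursive_fst sS.
have E n : iter n st (pair_nat 0 0) = pair_nat (n %/ d) (n %% d).
  elim: n => [|n IH]; first by rewrite div0n mod0n.
  rewrite iterS {}IH /st fst_natK snd_natK.
  have En := divn_eq n d; have rd := ltn_pmod n d0.
  case: eqP => [e|/eqP ne].
    have -> : n.+1 = (n %/ d).+1 * d by rewrite {1}En -addnS e mulSn addnC.
    by rewrite mulnK // modnMl.
  have lt : (n %% d).+1 < d by rewrite ltn_neqAle ne.
  have -> : n.+1 = n %/ d * d + (n %% d).+1 by rewrite addnS -En.
  by rewrite divnMDl // modnMDl (divn_small lt) addn0 (modn_small lt).
have Ri := recursive_iter (recursive_const (pair_nat 0 0)) Rs recursive_id.
split; [have := recursive_comp recursive_fst Ri | have := recursive_comp recursive_snd Ri];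
  by apply: eq_recursive => x n /=; rewrite E ?fst_natK ?snd_natK.
Qed.

Lemma recursive_mulDc N d r : recursive N -> recursive (fun x n => N x n * d + r).
Proof.
have Radd k M : recursive M -> recursive (fun x n => M x n + k).
  move=> RM; elim: k => [|k IH].
    by apply: eq_recursive RM => x n; rewrite addn0.
  by apply: eq_recursive (recursive_comp recursive_succ IH) => x n; rewrite addnS.
move=> RN; apply: (Radd r).
have := recursive_iter (recursive_const 0) (Radd d _ recursive_id) RN.
apply: eq_recursive => x n.
by elim: (N x n) => //= k ->; rewrite mulSn addnC.
Qed.

Definition bounded F := exists k, forall x n, F x n < k.

(** [Phi] is arbitrary, possibly not computable. Each datum takes finitely many values, so a case
    distinction on the first one turns it into a constant inside [Phi]. *)
Lemma recursive_finite_data (Fs : seq (cantor -> nat -> nat)) (Phi : seq nat -> nat) :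
  (forall i, i < size Fs -> recursive (nth (fun _ _ => 0) Fs i) /\
                            bounded (nth (fun _ _ => 0) Fs i)) ->
  recursive (fun x n => Phi [seq F x n | F <- Fs]).
Proof.
elim: Fs Phi => [|F Fs IH] Phi RF /=; first exact: recursive_const.
have [RF0 [k Fk]] := RF 0 isT.
have [|G RG E] := recursive_cases (k := k)
  (G := fun a x n => Phi (a :: [seq F x n | F <- Fs])).
  by move=> a _; apply: (IH (fun l => Phi (a :: l))) => i iF; apply: (RF i.+1).
have := recursive_comp RG (recursive_pair recursive_id RF0).
by apply: eq_recursive => x n; rewrite E.
Qed.

End RecursiveClosure.

(* The functional evaluates the data [Fs] and looks up the answer in a finite
   table, whose existence is not constructive. *)
Lemma medvedev_le_finite_data (Fs : seq (cantor -> nat -> nat)) (P Q : set cantor)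
    (R : cantor -> cantor -> Prop) :
  (forall i, i < size Fs -> recursive (nth (fun _ _ => 0) Fs i) /\
                            bounded (nth (fun _ _ => 0) Fs i)) ->
  (forall x, Q x -> exists2 y, P y & R x y) ->
  (forall x y x' y' n n', R x y -> R x' y' ->
     [seq F x n | F <- Fs] = [seq F x' n' | F <- Fs] -> y n = y' n') ->
  medvedev_le P Q.
Proof.
move=> RF QP det.
(* The table entry: data [l] occur together with output bit [b]. By the last hypothesis at most one
   [b] fits each [l]. *)
pose good l b := exists x y n, [/\ R x y, l = [seq F x n | F <- Fs] & b = y n].
have [e eP] := recursive_finite_data (fun l => `[< good l true >] : nat) RF.
exists e => x Qx; have [y Py xy] := QP x Qx; exists y => // n.
suff <- : `[< good [seq F x n | F <- Fs] true >] = y n by [].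
apply/asboolP/idP => [[x' [y' [n' [xy' E yn']]]]|yn].
  by rewrite (det _ _ _ _ _ _ xy xy' E) -yn'.
by exists x, y, n; split.
Qed.

(** * Computing with words *)

Lemma recursive_oracle_free F : recursive F -> recursive (fun=> F (fun=> false)).
Proof. by move=> [e eP]; apply: computable_recursive; exists e. Qed.

Lemma recursive_table (I : finType) (G : I -> nat -> nat) :
  (forall i, recursive (fun=> G i)) ->
  exists2 g : nat -> nat, recursive (fun=> g) &
    forall i n, g (pair_nat n (enum_rank i)) = G i n.
Proof.
move=> RG.
pose G' j := if insub j is Some o then G (enum_val (o : 'I_#|I|)) else id.
have RG' j : j < #|I| -> recursive (fun=> G' j) by move=> jI; rewrite /G' insubT.
have [g /recursive_oracle_free Rg E] := recursive_cases RG'.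
exists (g (fun=> false)) => // i n.
by rewrite E ?ltn_ord // /G' valK enum_rankK.
Qed.

Lemma size_word_code (T : finType) (w : seq T) : size w <= word_code w.
Proof. by elim: w => //= a w IH; rewrite ltnS (leq_trans IH) ?leq_pair_natr. Qed.

Lemma word_code_inj (T : finType) : injective (@word_code T).
Proof.
elim=> [|a v IH] [|b w] //= [] /pair_nat_inj [/ord_inj/enum_rank_inj-> E].
by rewrite (IH w).
Qed.

Lemma recursive_foldl (T : finType) (st : nat -> nat) :
  recursive (fun=> st) ->
  exists2 g : nat -> nat, recursive (fun=> g) &
    forall (w : seq T) acc, g (pair_nat (word_code w) acc) =
      foldl (fun acc a => st (pair_nat acc (enum_rank a))) acc w.
Proof.
move=> Rst.
(* A state pairs the code of the unread letters with the accumulator. Nonempty words have successor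
   codes, and the predecessor [c] packs first letter and tail. *)
pose step s := if fst_nat s is c.+1
  then pair_nat (snd_nat c) (st (pair_nat (snd_nat s) (fst_nat c))) else s.
(* [step] is idle once no letter remains, so any bound on the length of the word
   is a sufficient number of steps: the code of the word is one. *)
exists (fun n => snd_nat (iter (fst_nat n) step n)).
  apply: (recursive_comp recursive_snd).
  apply: (recursive_iter recursive_id _ recursive_fst).
  have RB : recursive (fun _ n => pair_nat (snd_nat (snd_nat n))
      (st (pair_nat (snd_nat (fst_nat n)) (fst_nat (snd_nat n))))).
    apply: recursive_pair; first exact: recursive_comp recursive_snd recursive_snd.
    apply: (recursive_comp Rst); apply: recursive_pair.
      exact: recursive_comp recursive_snd recursive_fst.
    exact: recursive_comp recursive_fst recursive_snd.
  apply: eq_recursive (recursive_natcase recursive_id RB recursive_fst) => x n.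
  by rewrite /step; case: (fst_nat n) => // c; rewrite fst_natK snd_natK.
suff iterE k (w : seq T) acc : size w <= k ->
    snd_nat (iter k step (pair_nat (word_code w) acc)) =
      foldl (fun acc a => st (pair_nat acc (enum_rank a))) acc w.
  by move=> w acc; rewrite fst_natK iterE ?size_word_code.
elim: k w acc => [|k IH] [|a w] acc //.
- by rewrite /= snd_natK.
- by move=> _; rewrite iterSr {2}/step fst_natK IH.
- rewrite ltnS => wk.
  by rewrite iterSr {2}/step fst_natK /= !snd_natK fst_natK IH.
Qed.

(** * Left multiplication of reduced words, and inversion of a numbering *)

Section Words.
Variables (G : groupType) (S : {fset G}).
Local Open Scope group_scope.

Definition letter (a : S * bool) : G := if a.2 then val a.1 else (val a.1)^-1.

Definition inv_letter (a : S * bool) : S * bool := (a.1, ~~ a.2).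

Definition lmul (a : S * bool) (w : seq (S * bool)) : seq (S * bool) :=
  if w is b :: w' then if b == inv_letter a then w' else a :: w else [:: a].

Lemma letter_inv a : letter (inv_letter a) = (letter a)^-1.
Proof. by case: a => s [] //=; rewrite /letter /= invgK. Qed.

Lemma lmul_reduced a w :
  sorted (@not_inverse G S) w -> sorted (@not_inverse G S) (lmul a w).
Proof.
case: w => //= b w pw; case: eqP => [_|/eqP ba]; first exact: path_sorted pw.
rewrite /= pw andbT /not_inverse; apply: contra ba.
case: a b {pw} => [s e] [t f] /= /andP[/eqP-> ef].
by rewrite /inv_letter xpair_eqE eqxx /=; case: e f ef => [] [].
Qed.

Definition flmul a (w : free_group S) : free_group S :=
  exist _ (lmul a (val w)) (lmul_reduced a (valP w)).

Lemma rho_flmul a w : rho (flmul a w) = letter a * rho w.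
Proof.
rewrite /rho /=; case: (val w) => [|b v] /=; first by rewrite big_seq1 big_nil mulg1.
case: eqP => [->|_]; last by rewrite big_cons.
by rewrite big_cons -!/(letter _) letter_inv mulVKg.
Qed.

Lemma rho_foldr_flmul v w :
  rho (foldr flmul w v) = (\prod_(a <- v) letter a) * rho w.
Proof.
elim: v => [|a v IH] /=; first by rewrite big_nil mul1g.
by rewrite rho_flmul IH big_cons mulgA.
Qed.

Lemma recursive_foldr_flmul v : exists2 g : nat -> nat, recursive (fun=> g) &
  forall w : free_group S, g (word_code (val w)) = word_code (val (foldr flmul w v)).
Proof.
elim: v => [|a v [g Rg gE]]; first by exists id; [apply: recursive_id|].
pose f c := if c is p.+1 then
    if fst_nat p == enum_rank (inv_letter a) :> nat then snd_nat p
    else (pair_nat (enum_rank a) c).+1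
  else (pair_nat (enum_rank a) 0).+1.
have Rf : recursive (fun=> f).
  have Rcons N : recursive N -> recursive (fun x n => (pair_nat (enum_rank a) (N x n)).+1).
    move=> RN; apply: (recursive_comp recursive_succ).
    exact: recursive_pair (recursive_const _) RN.
  have RB := recursive_ifeq (recursive_comp recursive_snd recursive_snd)
    (Rcons _ recursive_fst) (recursive_comp recursive_fst recursive_snd)
    (recursive_const (enum_rank (inv_letter a))).
  apply: eq_recursive (recursive_natcase (Rcons _ (recursive_const 0)) RB recursive_id).
  by move=> x [|p] //=; rewrite fst_natK snd_natK.
exists (fun n => f (g n)); first exact: recursive_comp Rf Rg.
move=> w; rewrite gE /=; case: (val (foldr _ _ _)) => //= b u.
rewrite fst_natK snd_natK (inj_eq (@ord_inj _)) (inj_eq enum_rank_inj).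
by case: eqP.
Qed.

(** Search for the index whose word has the same code as [f n]: bijectivity of [nu] makes it exist
    and be unique, and [num_computable] makes the test effective. *)
Lemma recursive_num_inverse (nu : numbering S) (f : nat -> free_group S) :
  recursive (fun _ n => word_code (val (f n))) ->
  exists2 q : nat -> nat, recursive (fun=> q) & forall n, nu (q n) = f n.
Proof.
move=> Rf; have [nu' nuK nuK'] := num_bij nu.
have Rc := computable_recursive (num_computable nu).
exists (fun n => nu' (f n)) => [|n]; last exact: nuK'.
pose F (_ : Defs.cantor) n := if word_code (val (f (fst_nat n))) ==
  word_code (val (nu (snd_nat n))) then 0 else 1%N.
have RF : recursive F.
  apply: recursive_ifeq; [exact: recursive_const|exact: recursive_const| |].
    exact: recursive_comp Rf recursive_fst.
  exact: recursive_comp Rc recursive_snd.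
apply: (recursive_mu RF) => [x n|x n i i_lt].
  by rewrite /F fst_natK snd_natK nuK' eqxx.
rewrite /F fst_natK snd_natK (inj_eq (@word_code_inj _)) (inj_eq val_inj).
by case: (f n =P nu i) => // fi; rewrite fi nuK ltnn in i_lt.
Qed.

End Words.

(** * Finite-state transducers from words over [S] to [H] *)

Section Transducer.
Variables (G H : groupType) (S : {fset G}) (T : {fset H}).
Variables (nuS : numbering S) (nuT : numbering T).
Variables (Q : finType) (delta : Q -> S * bool -> Q) (beta : Q -> S * bool -> H).
Local Open Scope group_scope.

Definition transduce (sb : Q * H) (w : seq (S * bool)) : Q * H :=
  foldl (fun sb a => (delta sb.1 a, beta sb.1 a * sb.2)) sb w.

Lemma recursive_transduce (s0 : Q) (b0 : H) : generates T ->
  exists q sigma : nat -> nat,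
    [/\ recursive (fun=> q), recursive (fun=> sigma) &
     forall n, let sb := transduce (s0, b0) (val (nuS n)) in
       sigma n = enum_rank sb.1 /\ rho (nuT (q n)) = sb.2].
Proof.
move=> genT.
have [wd wdE] := choice (fun sa => genT (beta sa.1 sa.2)).
have [v0 v0E] := genT b0.
(* The machine is lifted from [H] to the free group on [T]: each of the finitely many outputs of
   [beta] is replaced by a fixed word representing it. *)
pose stw (sv : Q * free_group T) a :=
  (delta sv.1 a, foldr (@flmul _ T) sv.2 (val (wd (sv.1, a)))).
pose cd (sv : Q * free_group T) := pair_nat (word_code (val sv.2)) (enum_rank sv.1).
have /choice[h hE] : forall a : S * bool, exists h, recursive (fun=> h) /\
    forall sv, h (cd sv) = cd (stw sv a).
  move=> a.
  have /choice[g gE] : forall s, exists g, recursive (fun=> g) /\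
      forall v : free_group T, g (word_code (val v)) =
        word_code (val (foldr (@flmul _ T) v (val (wd (s, a))))).
    by move=> s; have [g] := recursive_foldr_flmul (val (wd (s, a))); exists g.
  pose G0 s n := pair_nat (g s n) (enum_rank (delta s a)).
  have RG0 s : recursive (fun=> G0 s).
    by apply: recursive_pair (recursive_const _); have [] := gE s.
  have [k Rk kE] := recursive_table RG0.
  exists k; split=> // -[s v]; rewrite /cd kE /G0 /=.
  by have [_ ->] := gE s.
have [st Rst stE] := recursive_table (fun a => (hE a).1).
have [g Rg gE] := recursive_foldl (S * bool)%type Rst.
pose run_st n := foldl stw (s0, v0) (val (nuS n)).
have Erun n : g (pair_nat (word_code (val (nuS n))) (cd (s0, v0))) = cd (run_st n).
  rewrite gE /run_st; move: (s0, v0) (val _) => sv w.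
  by elim: w sv => //= a w IH sv; rewrite stE (hE a).2 IH.
have Rrun : recursive (fun _ n => cd (run_st n)).
  have := recursive_comp Rg (recursive_pair
    (computable_recursive (num_computable nuS)) (recursive_const (cd (s0, v0)))).
  by apply: eq_recursive => x n; rewrite Erun.
have [q Rq qE] : exists2 q : nat -> nat, recursive (fun=> q) &
    forall n, nuT (q n) = (run_st n).2.
  apply: recursive_num_inverse.
  apply: eq_recursive (recursive_comp recursive_fst Rrun) => x n.
  by rewrite fst_natK.
exists q, (fun n => enum_rank (run_st n).1 : nat); split=> //.
  apply: eq_recursive (recursive_comp recursive_snd Rrun) => x n.
  by rewrite snd_natK.
move=> n; rewrite qE /run_st.
suff -> : transduce (s0, b0) (val (nuS n)) =
    ((foldl stw (s0, v0) (val (nuS n))).1, rho (foldl stw (s0, v0) (val (nuS n))).2).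
  by [].
rewrite -v0E -[(s0, rho v0)]/((s0, v0).1, rho (s0, v0).2).
move: (s0, v0) (val _) => sv w.
elim: w sv => [|a w IH] [s v] //=.
rewrite -IH /= rho_foldr_flmul.
by rewrite -[\prod_(_ <- _) _]/(rho (wd (s, a))) wdE.
Qed.

End Transducer.

(** * Medvedev reductions between coded configurations *)

Lemma encode_digit (G : groupType) (S : {fset G}) (nu : numbering S) (A : finType)
    (c : coding A) (y : free_group S -> A) n (r : 'I_(width c).+1) :
  encode nu c y (n * (width c).+1 + r) = tnth (c (y (nu n))) r.
Proof.
rewrite /encode divnMDl // divn_small // addn0 modnMDl modn_small //.
by rewrite (tnth_nth false).
Qed.

(** Each letter of [x] is determined by a bounded label and by finitely many letters of [y] at
    recursively computed positions. Hence each output bit depends on bounded recursive data, and the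
    arbitrary map [Theta] is absorbed into a finite table. *)
Lemma medvedev_le_encode (G H : groupType) (S : {fset G}) (T : {fset H})
    (nuS : numbering S) (nuT : numbering T) (A B : finType)
    (cA : coding A) (cB : coding B) (I : finType) (q : I -> nat -> nat)
    (sigma : nat -> nat) (k : nat) (Theta : nat -> (I -> B) -> A)
    (P : set (free_group S -> A)) (Q : set (free_group T -> B)) :
  (forall i, recursive (fun=> q i)) ->
  recursive (fun=> sigma) -> (forall n, sigma n < k) ->
  (forall y, Q y -> exists2 x, P x &
     forall n, x (nuS n) = Theta (sigma n) (fun i => y (nuT (q i n)))) ->
  medvedev_le (encode nuS cA @` P) (encode nuT cB @` Q).
Proof.
move=> Rq Rs sk QP.
set wA := (width cA).+1; set wB := (width cB).+1.
have [Rdiv Rmod] := recursive_divmod (isT : 0 < wA).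
(* Output bit [n] belongs to the letter numbered [n %/ wA]; the oracle is asked for each bit of each
   letter on which that one depends. *)
pose bit (ir : I * 'I_wB) (z : Defs.cantor) n :=
  nat_of_bool (z (q ir.1 (n %/ wA) * wB + ir.2)).
pose Fs := [:: (fun _ n => sigma (n %/ wA)), (fun _ n => n %% wA)
             & [seq bit ir | ir <- enum {: I * 'I_wB}]].
apply: (medvedev_le_finite_data (Fs := Fs) (R := fun z w => exists x y,
  [/\ z = encode nuT cB y, w = encode nuS cA x &
   forall n, x (nuS n) = Theta (sigma n) (fun i => y (nuT (q i n)))])).
- case=> [_|[_|i]] /=.
  + by split; [exact: recursive_comp Rs Rdiv | exists k].
  + by split=> //; exists wA => x n; apply: ltn_pmod.
  rewrite size_map !ltnS => iI; have [ir0] : exists ir : I * 'I_wB, True.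
    by case: (enum _) iI => // ir; exists ir.
  move=> _; rewrite (nth_map ir0) //; move: (nth _ _ _) => ir; split; last first.
    by exists 2 => x n; rewrite /bit; case: (x _).
  apply: (recursive_comp recursive_oracle).
  by apply: recursive_mulDc; exact: recursive_comp (Rq ir.1) Rdiv.
- move=> _ [y Qy <-]; have [x Px xE] := QP y Qy.
  by exists (encode nuS cA x); [exists x | exists x, y].
move=> _ _ _ _ n n' [x [y [-> -> xE]]] [x' [y' [-> -> xE']]] [Es Em].
rewrite -!map_comp => /eq_in_map Eb.
rewrite /encode -/wA Em; congr (nth _ (cA _) _); rewrite xE xE' Es.
congr (Theta _ _); apply/funext => i; apply: (enc_inj (c := cB)).
apply: eq_from_tnth => r; rewrite -!encode_digit.
have := Eb (i, r); rewrite -enumT mem_enum => /(_ isT); rewrite /bit /= -/wB.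
by case: (encode _ _ _ _); case: (encode _ _ _ _).
Qed.

Local Open Scope classical_set_scope.

(** * Subshifts *)

Section FullshiftTopology.
Variables (G : groupType) (A : finType).
Implicit Type x : fullshift G A.

Lemma nbhs_eval x g : nbhs x [set y : fullshift G A | y g = x g].
Proof.
exact: (@proj_continuous G (fun=> discrete_topology A) g x [set x g] (discrete_set1 _)).
Qed.

Lemma cvg_fullshift (F : set_system (fullshift G A)) x : Filter F ->
  F --> x <-> forall g, \forall y \near F, y g = x g.
Proof.
move=> FF; split=> [Fx g|Fx]; first exact: Fx (nbhs_eval x g).
apply/cvg_sup => g U [B [[V _ <-] Vx] VU].
by apply: filterS (Fx g) => y yx; apply: VU; rewrite /= yx.
Qed.

End FullshiftTopology.

(** The forbidden patterns are the restrictions to [W] of configurations violating [P]; they are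
    finitely many because [W] and [A] are finite. *)
Lemma SFT_window (G : groupType) (A : finType) (X : set (fullshift G A))
    (W : {fset G}) (P : fullshift G A -> Prop) :
  subshift X ->
  (forall x y, (forall g, g \in W -> x g = y g) -> P x -> P y) ->
  (forall x, X x <-> forall g, P (translate g x)) ->
  SFT X.
Proof.
move=> sX PW XP; split=> //.
pose pat (q : {ffun W -> A}) : {fmap G -> A} := [fmap h : W => q h]%fmap.
have patE (q : {ffun W -> A}) (h : W) : ((pat q).[? val h])%fmap = Some (q h).
  by rewrite -(@Some_fnd _ _ (pat q) h) ffunE.
pose bad (q : {ffun W -> A}) :=
  `[< exists2 x, ~ P x & forall h : W, x (val h) = q h >].
exists [fset p in [seq pat q | q <- enum {ffun W -> A} & bad q]]%fset.
apply/seteqP; split=> x.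
  move=> /XP Px g p; rewrite inE /= => /mapP[q].
  rewrite mem_filter => /andP[/asboolP[y Py yq] _] -> cyl.
  apply: Py; apply: PW (Px g) => h hW; rewrite -[h]/(val [` hW]%fset) yq.
  exact: cyl (patE _ _).
move=> /= nF; apply/XP => g; apply: contrapT => nP.
pose q := [ffun h : W => (translate g x (val h) : A)].
apply: (nF g (pat q)).
  rewrite inE /=; apply/map_f; rewrite mem_filter mem_enum andbT.
  by apply/asboolP; exists (translate g x) => // h; rewrite ffunE.
move=> h a; case: fndP => // hW [<-].
by rewrite /= !ffunE.
Qed.

(** * Finite-index subgroups *)

(** Inversion turns left cosets into right cosets: [tau g] is the left coset of the inverse of [g],
    and [t] inverts a chosen representative. *)
Lemma right_transversal (G : groupType) (K : groupClosed G) : finite_index K ->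
  exists (Q : finType) (t : Q -> G) (tau : G -> Q),
    (forall g, (g * (t (tau g))^-1)%g \in K) /\
    (forall k g, k \in K -> tau (k * g)%g = tau g) /\
    (forall i, tau (t i) = i).
Proof.
pose coset g := [set (g * k)%g | k in [set` K]].
have mem_coset g h : coset g = coset h -> coset g h.
  by move=> ->; exists 1%g; [exact: gpred1 | rewrite mulg1].
move=> /finite_fsetP[F FE].
have cF g : coset g^-1%g \in F.
  by have : [set` F] (coset g^-1%g) by rewrite -FE; exists g^-1%g.
have /choice[r rE] : forall q : F, exists g, coset g = val q.
  move=> q; have : [set` F] (val q) by exact: valP.
  by rewrite -FE => -[g _ <-]; exists g.
exists F, (fun q => (r q)^-1%g), (fun g => [` cF g]%fset); split=> [g|].
  have : coset g^-1%g (r [` cF g]%fset).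
    by apply: mem_coset; rewrite rE.
  by move=> [k Kk <-]; rewrite invgK mulVKg.
split=> [k g Kk|q]; last by apply: val_inj; rewrite /= invgK rE.
apply: val_inj => /=; apply/seteqP; split=> _ [l /= Kl <-].
  by exists (k^-1 * l)%g; rewrite /= ?gpredM ?gpredV // invgM mulgA.
by exists (k * l)%g; rewrite /= ?gpredM // invgM -mulgA mulKg.
Qed.

Section Transversal.
Variables (G H : groupType) (K : groupClosed G) (f : G -> H).
Hypothesis fM : {in K &, {morph f : x y / (x * y)%g}}.
Variables (Q : finType) (t : Q -> G) (tau : G -> Q).
Hypothesis kappaK : forall g, (g * (t (tau g))^-1)%g \in K.
Hypothesis tauM : forall k g, k \in K -> tau (k * g)%g = tau g.
Local Open Scope group_scope.

Definition kappa g : G := g * (t (tau g))^-1.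

Lemma kappaM k g : k \in K -> kappa (k * g) = k * kappa g.
Proof. by move=> Kk; rewrite /kappa tauM // mulgA. Qed.

Lemma kappa_tau g : kappa g * t (tau g) = g.
Proof. exact: mulgVK. Qed.

Lemma morph1 : f 1 = 1.
Proof. by apply: (mulgI (f 1)); rewrite -fM ?gpred1 // !mulg1. Qed.

Lemma morphV k : k \in K -> f k^-1 = (f k)^-1.
Proof.
by move=> Kk; apply: (mulgI (f k)); rewrite mulgV -fM ?gpredV // mulgV morph1.
Qed.

(* Reading [g] letter by letter amounts to walking on the Schreier graph of
   [K \ G]; the Schreier generators met on the way are multiplied on the left,
   which is why the inverse of [f (kappa g)] is produced. *)
Lemma recursive_schreier (S : {fset G}) (T : {fset H}) (nuS : numbering S)
    (nuT : numbering T) (b : H) : generates T ->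
  exists q sigma : nat -> nat,
    [/\ recursive (fun=> q), recursive (fun=> sigma) &
     forall n, let g := rho (nuS n) in
       sigma n = enum_rank (tau g) /\ rho (nuT (q n)) = (f (kappa g))^-1 * b].
Proof.
move=> genT.
pose delta s (a : S * bool) := tau (t s * letter a).
pose beta s (a : S * bool) := (f (kappa (t s * letter a)))^-1.
have step g0 w : transduce delta beta (tau g0, (f (kappa g0))^-1 * b) w =
    (tau (g0 * \prod_(a <- w) letter a),
     (f (kappa (g0 * \prod_(a <- w) letter a)))^-1 * b).
  elim: w g0 => [|a w IH] g0; first by rewrite big_nil mulg1.
  (* The factor [kappa g0] lies in [K], so it does not affect [tau] and comes out of [kappa]: the
     new output depends only on the coset and the letter. *)
  have E : g0 * letter a = kappa g0 * (t (tau g0) * letter a).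
    by rewrite mulgA kappa_tau.
  rewrite big_cons mulgA -IH /= /delta /beta E (tauM _ (kappaK g0)).
  by rewrite (kappaM _ (kappaK g0)) fM ?kappaK // invgM mulgA.
have [q [sigma [Rq Rs qsE]]] := recursive_transduce nuS nuT delta beta
  (tau 1) ((f (kappa 1))^-1 * b) genT.
exists q, sigma; split=> // n.
by have := qsE n; rewrite step mul1g.
Qed.

End Transversal.

(** A one-state transducer suffices: multiplying inverse letters on the left reverses their order,
    as inversion does. *)
Lemma recursive_inverse (G : groupType) (S : {fset G}) (nu : numbering S) :
  generates S -> exists2 q : nat -> nat, recursive (fun=> q) &
    forall n, rho (nu (q n)) = (rho (nu n))^-1%g.
Proof.
move=> genS.
have [q [sigma [Rq _ qE]]] := recursive_transduce nu nu
  (fun (_ : unit) _ => tt) (fun _ a => (letter a)^-1%g) tt 1%g genS.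
exists q => // n; rewrite (qE n).2.
suff E (w : seq (S * bool)) sb :
    (transduce (fun _ _ => tt) (fun _ a => (letter a)^-1%g) sb w).2 =
    ((\prod_(a <- w) letter a)^-1 * sb.2)%g by rewrite E mulg1.
elim: w sb => [|a w IH] sb; first by rewrite big_nil invg1 mul1g.
by rewrite big_cons invgM -mulgA IH.
Qed.

(** * Induced subshifts *)

Section InducedSubshift.
Variables (G H : groupType) (K : groupClosed G) (L : groupClosed H).
Variables (f : G -> H) (f' : H -> G).
Hypothesis fM : {in K &, {morph f : x y / (x * y)%g}}.
Hypothesis f'M : {in L &, {morph f' : x y / (x * y)%g}}.
Hypothesis fL : forall k, k \in K -> f k \in L.
Hypothesis f'K : forall l, l \in L -> f' l \in K.
Hypothesis fC : {in K, cancel f f'}.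
Hypothesis f'C : {in L, cancel f' f}.

Variables (Q : finType) (t : Q -> G) (tau : G -> Q).
Hypothesis kappaK : forall g, (g * (t (tau g))^-1)%g \in K.
Hypothesis tauM : forall k g, k \in K -> tau (k * g)%g = tau g.

Hypothesis tau_t : forall i, tau (t i) = i.

Variables (R : finType) (u : R -> H) (upsilon : H -> R).
Hypothesis kappaL : forall h, (h * (u (upsilon h))^-1)%g \in L.
Hypothesis upsilonM : forall l h, l \in L -> upsilon (l * h)%g = upsilon h.

Local Open Scope group_scope.

Local Notation kappa := (kappa t tau).

Lemma kappa_t i : kappa (t i) = 1.
Proof. by rewrite /kappa tau_t mulgV. Qed.

(** The right transversal applied to [h^-1] yields a decomposition along left cosets: [lrep h]
    depends only on the coset [h L], and [lambda h] lies in [L]. *)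
Definition lambda h : H := u (upsilon h^-1) * h.
Definition lrep h : H := (u (upsilon h^-1))^-1.

Lemma lambdaL h : lambda h \in L.
Proof. by have := kappaL h^-1; rewrite -gpredV invgM !invgK. Qed.

Lemma lambdaM h l : l \in L -> lambda (h * l) = lambda h * l.
Proof. by move=> Ll; rewrite /lambda invgM upsilonM ?gpredV // mulgA. Qed.

Lemma lrepM h l : l \in L -> lrep (h * l) = lrep h.
Proof. by move=> Ll; rewrite /lrep invgM upsilonM ?gpredV. Qed.

Lemma lrep_lambda h : lrep h * lambda h = h.
Proof. exact: mulKg. Qed.

Section Alphabet.
Variable A : finType.

(* The [G]-configuration carried by the left coset [h L] of a [H]-configuration
   with letters in [A^Q]: the fundamental domain of [K] at [k] is stored
   at [h f(k)]. *)
Definition unfold (y : fullshift H {ffun Q -> A}) (h : H) : fullshift G A :=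
  fun g => y (h * f (kappa g)) (tau g).

(** Only the values of [z] at coset representatives enter, so each left coset carries one
    configuration, chosen independently of the others. *)
Definition fold (z : H -> fullshift G A) : fullshift H {ffun Q -> A} :=
  fun h => [ffun i => z (lrep h) (f' (lambda h) * t i)].

Lemma unfold_inj y y' : unfold y = unfold y' -> y = y'.
Proof.
move=> E; apply/funext => h; apply/ffunP => i.
have := congr1 (fun z => z h (t i)) E.
by rewrite /unfold kappa_t (morph1 fM) mulg1 tau_t.
Qed.

Lemma unfold_translate h0 y h : unfold (translate h0 y) h = unfold y (h0^-1 * h).
Proof. by apply/funext => g; rewrite /unfold /translate mulgA. Qed.

(** Moving the base point inside its left coset only translates the configuration; for
    shift-invariant [X] this leaves one condition per coset. *)
Lemma unfoldM y h k : k \in K -> unfold y (h * f k) = translate k^-1 (unfold y h).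
Proof.
move=> Kk; apply/funext => g.
by rewrite /unfold /translate invgK (kappaM t tauM) // tauM // fM ?kappaK // mulgA.
Qed.

Lemma unfold_fold z h :
  unfold (fold z) h = translate (f' (lambda h))^-1 (z (lrep h)).
Proof.
apply/funext => g; rewrite /unfold /fold ffunE /translate invgK.
have fkL : f (kappa g) \in L by apply: fL; exact: kappaK.
rewrite lrepM // lambdaM // f'M ?lambdaL // fC ?kappaK //.
by rewrite -mulgA kappa_tau.
Qed.

(** Quantifying over all base points, not only representatives, makes shift invariance immediate. *)
Definition induced (X : set (fullshift G A)) : set (fullshift H {ffun Q -> A}) :=
  [set y | forall h, X (unfold y h)].

Lemma unfold_continuous h : continuous (unfold^~ h).
Proof.
move=> y; have FF : Filter (unfold^~ h @ nbhs y) by apply: fmap_filter.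
apply/cvg_fullshift => g.
by apply: filterS (nbhs_eval y (h * f (kappa g))) => y' /= E; rewrite /unfold E.
Qed.

Lemma induced_subshift X : subshift X -> subshift (induced X).
Proof.
move=> [cX sX]; split=> [|h y Xy h0]; last by rewrite unfold_translate.
have -> : induced X = \bigcap_h (unfold^~ h @^-1` X).
  by apply/seteqP; split=> y Xy h; [move=> _|]; apply: Xy.
by apply: closed_bigI => h _; apply: preimage_closed => // y _; apply: unfold_continuous.
Qed.

Lemma fold_induced X (z : H -> fullshift G A) :
  subshift X -> (forall h, X (z h)) -> induced X (fold z).
Proof. by move=> [_ sX] Xz h; rewrite unfold_fold; apply: sX. Qed.

(** A pattern of [X] has to be tested at every place [k * t i] of every coset. By [unfoldM] the
    factor [k] becomes a change of base point, so testing at the finitely many [t i] from base point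
    1, in all translates, is enough. *)
Lemma induced_SFT X : SFT X -> SFT (induced X).
Proof.
move=> [sX [F XE]].
(* These are the positions of [H] consulted when patterns of [F] are tested at the points [t i]. *)
pose W := [fset h in [seq f (kappa (t i * v)) | i <- enum Q,
                          v <- \bigcup_(p <- F) domf p]]%fset.
pose P (y : fullshift H {ffun Q -> A}) := forall i p, p \in F ->
  ~ cylinder p (translate (t i)^-1 (unfold y 1)).
apply: (SFT_window (W := W) (P := P)); first exact: induced_subshift.
  move=> y y' yy' Py i p pF cyl; apply: (Py i p pF) => v a pv.
  rewrite -(cyl v a pv) /translate invgK /unfold mul1g yy' // inE /=.
  apply/allpairsP; exists (i, v) => /=; split=> //; first by rewrite mem_enum.
  apply/bigfcupP; exists p; first by rewrite andbT.
  by have := fndSome p v; rewrite pv.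
have translate_t y h k i : k \in K ->
    translate (t i)^-1 (unfold (translate (h * f k)^-1 y) 1) =
    translate (k * t i)^-1 (unfold y h).
  move=> Kk; rewrite unfold_translate invgK mulg1 unfoldM //.
  by apply/funext => v; rewrite /translate !invgK mulgA.
move=> y; split=> [Xy h i p pF|Py h].
  have := Xy h^-1; rewrite XE => /(_ (t i)^-1 p pF).
  by rewrite unfold_translate mulg1.
rewrite XE => g p pF.
have := Py (h * f (kappa g^-1))^-1 (tau g^-1) p pF.
by rewrite translate_t ?kappaK // kappa_tau invgK.
Qed.

End Alphabet.

(** The factor map acts coset by coset. Continuity survives because a letter has finitely many
    components, and surjectivity because cosets are independent. *)
Lemma induced_sofic (A : finType) (X : set (fullshift G A)) :
  sofic X -> sofic (induced X).
Proof.
move=> [sX [B [Z [phi [SZ cphi ephi XE]]]]]; split; first exact: induced_subshift.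
have [sZ _] := SZ.
pose psi (z : fullshift H {ffun Q -> B}) : fullshift H {ffun Q -> A} :=
  fun h => [ffun i => phi (unfold z h) (t i)].
(* Equivariance of [phi] on [Z] extends the defining formula of [psi] from the points [t i] to all
   of [G]. *)
have unfold_psi z h : induced Z z -> unfold (psi z) h = phi (unfold z h).
  move=> Zz; apply/funext => g; rewrite /unfold -/(unfold z h) ffunE.
  rewrite unfoldM ?kappaK // ephi; last exact: Zz.
  by rewrite /translate invgK kappa_tau.
exists {ffun Q -> B}, (induced Z), psi; split; first exact: induced_SFT.
- apply/subspace_continuousP => z Zz; apply/cvg_fullshift => h.
  have ev i : \forall z' \near within (induced Z) (nbhs z),
      phi (unfold z' h) (t i) = phi (unfold z h) (t i).
    have nphi : nbhs (unfold z h)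
        [set x | Z x -> phi x (t i) = phi (unfold z h) (t i)].
      have cphi_h := (subspace_continuousP _ _).1 cphi _ (Zz h).
      exact: cphi_h (nbhs_eval _ (t i)).
    have := unfold_continuous nphi.
    by apply: (@filterS _ (nbhs z)) => z' /= Ez Zz'; apply: Ez; apply: Zz'.
  have Fz : Filter (within (induced Z) (nbhs z)) by apply: within_filter.
  have := filter_forall Fz ev.
  by apply: (@filterS _ _ Fz) => z' E; apply/ffunP => i; rewrite !ffunE E.
- move=> h z _; apply/funext => h0; apply/ffunP => i.
  by rewrite /translate !ffunE unfold_translate.
apply/seteqP; split=> [y Xy|_ [z Zz <-] h]; last first.
  by rewrite unfold_psi // XE; exists (unfold z h) => //; apply: Zz.
(* Preimages chosen at base points of one coset may be incompatible; folding keeps only the one at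
   its representative. *)
have /choice[z zE] : forall h, exists z, Z z /\ phi z = unfold y h.
  by move=> h; have := Xy h; rewrite XE => -[z]; exists z.
have Zz := fold_induced sZ (fun h => (zE h).1).
exists (fold z) => //; apply: unfold_inj; apply/funext => h.
rewrite unfold_psi // unfold_fold ephi; last exact: (zE _).1.
rewrite (zE _).2 -unfoldM ?f'K ?lambdaL // f'C ?lambdaL //.
by rewrite lrep_lambda.
Qed.

(** * Medvedev equivalence of a subshift and its induced subshift *)

Section Degree.
Variables (S : {fset G}) (T : {fset H}) (nuS : numbering S) (nuT : numbering T).
Hypotheses (genS : generates S) (genT : generates T).
Variables (A : finType) (cA : coding A) (cB : coding {ffun Q -> A}).
Variable X : set (fullshift G A).

(** The coset of 1 already carries a point of [X]. Its value at [g] is the component [tau g] of the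
    letter at [f (kappa g)], so one queried letter and a finite label suffice. *)
Lemma medvedev_le_unfold : medvedev_le
  (encode nuS cA @` pullback X) (encode nuT cB @` pullback (induced X)).
Proof.
have [inv Rinv invE] := recursive_inverse nuT genT.
have [q [sigma [Rq Rs qsE]]] := recursive_schreier fM kappaK tauM nuS nuT 1 genT.
(* [inv] undoes the inverse produced by the Schreier walk; [sigma] is a rank in [Q], so the default
   [tau 1] of [nth] is never reached. *)
apply: (@medvedev_le_encode _ _ _ _ nuS nuT _ _ cA cB unit (fun _ n => inv (q n))
  sigma #|Q| (fun s v => v tt (nth (tau 1) (enum Q) s))
  (pullback X) (pullback (induced X))).
- by move=> _; exact: (recursive_comp Rinv Rq).
- exact: Rs.
- by move=> n; rewrite (qsE n).1 ltn_ord.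
move=> _ [y Xy <-]; exists (fun w => unfold y 1 (rho w)).
  by exists (unfold y 1) => //; apply: Xy.
move=> n; have [-> qE] := qsE n.
by rewrite nth_enum_rank invE qE mulg1 invgK /unfold mul1g.
Qed.

(** With the same [x] on every coset, [lrep h] drops out: the letter at [h] consists of the values
    of [x] at the points [f' (lambda h) * t i]. *)
Lemma medvedev_le_fold : subshift X -> medvedev_le
  (encode nuT cB @` pullback (induced X)) (encode nuS cA @` pullback X).
Proof.
move=> sX; have [inv Rinv invE] := recursive_inverse nuT genT.
have /choice[q qE] : forall i, exists q : nat -> nat, recursive (fun=> q) /\
    forall n, rho (nuS (q n)) = f' (lambda (rho (nuT n))) * t i.
  (* [lambda h] is the inverse of the [L]-part of [h^-1], so the Schreier walk is run on [h^-1] with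
     right factor [t i]. *)
  move=> i; have [q [sigma [Rq _ qE]]] :=
    recursive_schreier f'M kappaL upsilonM nuT nuS (t i) genS.
  exists (fun n => q (inv n)); split=> [|n]; first exact: recursive_comp Rq Rinv.
  rewrite (qE _).2 invE -(morphV f'M) ?kappaL //.
  by rewrite invgM !invgK.
apply: (@medvedev_le_encode _ _ _ _ nuT nuS _ _ cB cA Q q (fun=> 0) 1%N
  (fun _ v => [ffun i => v i]) (pullback (induced X)) (pullback X)).
- by move=> i; have [] := qE i.
- exact: recursive_const.
- by [].
move=> _ [x Xx <-]; exists (fun w => fold (fun=> x) (rho w)).
  by exists (fold (fun=> x)) => //; apply: fold_induced.
move=> n; apply/ffunP => i; rewrite !ffunE.
by have [_ ->] := qE i.
Qed.

Lemma degree_induced :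
  subshift X -> degree nuT cB (induced X) = degree nuS cA X.
Proof.
move=> sX; apply: eq_medvedev_degree.
  exact: medvedev_le_fold.
exact: medvedev_le_unfold.
Qed.

End Degree.

End InducedSubshift.

(** * Symmetry of commensurability and equality of the sets of degrees *)

Lemma isomorphic_subgroupsP (G H : groupType) (K : groupClosed G) (L : groupClosed H) :
  isomorphic_subgroups K L -> exists (f : G -> H) (f' : H -> G),
    [/\ {in K &, {morph f : x y / (x * y)%g}} /\
        {in L &, {morph f' : x y / (x * y)%g}},
        forall k, k \in K -> f k \in L,
        forall l, l \in L -> f' l \in K,
        {in K, cancel f f'} & {in L, cancel f' f}].
Proof.
move=> [f fM [fL f_inj f_surj]].
have /choice[f' f'P] : forall l, exists k, l \in L -> k \in K /\ f k = l.
  (* Outside [L] any value will do; 1 is a witness. *)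
  move=> l; have [lL|lL] := boolP (l \in L); last by exists 1%g.
  by have [k kK kl] := f_surj l lL; exists k.
have f'K l : l \in L -> f' l \in K by case/f'P.
have f'C : {in L, cancel f' f} by move=> l /f'P[].
have fC : {in K, cancel f f'}.
  move=> k kK; apply: f_inj; rewrite ?inE //=; first exact/f'K/fL.
  exact/f'C/fL.
exists f, f'; split=> //; split=> // x y xL yL.
have e : f (f' x * f' y)%g = (x * y)%g by rewrite fM ?f'K // !f'C.
by rewrite -e fC // gpredM ?f'K.
Qed.

Lemma commensurable_sym (G H : groupType) : commensurable G H -> commensurable H G.
Proof.
move=> [K [L [fiK fiL /isomorphic_subgroupsP]]].
move=> [f [f' [[fM f'M] fL f'K fC f'C]]].
exists L, K; split=> //; exists f' => //; split=> //.
- by move=> x y /[!inE] xL yL E; rewrite -(f'C x) // E f'C.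
- by move=> k kK; exists (f k); [apply: fL | apply: fC].
Qed.

(** Generating sets, numberings and codings are independent on the two sides, so exchanging the
    groups gives the reverse inclusions. *)
Lemma commensurable_subset (G H : groupType) (S : {fset G}) (T : {fset H})
    (nuS : numbering S) (nuT : numbering T)
    (cG cH : forall A : finType, coding A) :
  generates S -> generates T -> commensurable G H ->
  M_SFT nuS cG `<=` M_SFT nuT cH /\ M_SOF nuS cG `<=` M_SOF nuT cH.
Proof.
move=> genS genT [K [L [fiK fiL /isomorphic_subgroupsP]]].
move=> [f [f' [[fM f'M] fL f'K fC f'C]]].
have [Q [t [tau [kappaK [tauM tau_t]]]]] := right_transversal fiK.
have [R [u [ups [kappaL [upsM _]]]]] := right_transversal fiL.
pose ind A (X : set (fullshift G A)) := induced f t tau X.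
have ind_ne A (X : set (fullshift G A)) : subshift X -> X !=set0 -> ind A X !=set0.
  move=> sX [x Xx]; exists (fold f' t u ups (fun=> x)).
  exact: (fold_induced f'M fL fC kappaK kappaL upsM).
have ind_deg A (X : set (fullshift G A)) : subshift X ->
    degree nuS (cG A) X = degree nuT (cH _) (ind A X).
  by move=> sX; rewrite (degree_induced fM f'M fL fC kappaK tauM kappaL upsM nuS nuT
    genS genT (cG A)).
split=> _ [A [X [cX neX ->]]]; have sX := cX.1; exists {ffun Q -> A}, (ind A X); split.
- exact: (induced_SFT fM kappaK tauM).
- exact: ind_ne.
- exact: ind_deg.
- exact: (induced_sofic fM f'M fL f'K fC f'C kappaK tauM tau_t kappaL upsM).
- exact: ind_ne.
- exact: ind_deg.
Qed.

Theorem proposition4p7 (G H : groupType) (S : {fset G}) (T : {fset H})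
    (nuS : numbering S) (nuT : numbering T)
    (cG cH : forall A : finType, coding A) :
  generates S -> generates T -> commensurable G H ->
  M_SFT nuS cG = M_SFT nuT cH /\ M_SOF nuS cG = M_SOF nuT cH.
Proof.
move=> genS genT GH.
have [s1 s2] := commensurable_subset nuS nuT cG cH genS genT GH.
have [s3 s4] := commensurable_subset nuT nuS cH cG genT genS (commensurable_sym GH).
by split; apply/seteqP.
Qed.
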